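(* Let $n\ge 2$ and let $\beta_{i1},\beta_{i2},\beta_{i3}$ ($i=2,\dots,n$) be arbitrary positive real numbers. For both the ring-road and the open-road mixed traffic system $\dot x(t)=Ax(t)+Bu(t)$ (with $A,B$ as defined in the context for each of the two cases), the pair $(A,B)$ is stabilizable.
   Context: Mixed traffic system with $n\ge 2$ vehicles (vehicle 1 is the automated vehicle, vehicles $2,\dots,n$ are human-driven), state $x\in\mathbb{R}^{2n}$, partitioned into blocks of size 2. The matrix $A\in\mathbb{R}^{2n\times 2n}$, viewed as an $n\times n$ array of $2\times2$ blocks, is the sum of the following block contributions, all other blocks being zero: block $(1,1)$ contains $J_1=\begin{bmatrix}0&-1\\0&0\end{bmatrix}$; block $(1,n)$ contains $J_2$; and for $i=2,\dots,n$, block $(i,i-1)$ is $A_{i1}=\begin{bmatrix}0&1\\0&\beta_{i3}\end{bmatrix}$ and block $(i,i)$ is $A_{i2}=\begin{bmatrix}0&-1\\ \beta_{i1}&-\beta_{i2}\end{bmatrix}$. The standing assumption is $\beta_{i1}>0,\ \beta_{i2}>0,\ \beta_{i3}>0$ for $i=2,\dots,n$. Ring-road case: $J_2=\begin{bmatrix}0&1\\0&0\end{bmatrix}$ and $B\in\mathbb{R}^{2n\times1}$ has first $2\times 1$ block $\begin{bmatrix}0\\1\end{bmatrix}$ and all other blocks zero (so $B=e_2$). Open-road case: $J_2=0_{2\times2}$ and $B\in\mathbb{R}^{2n\times2}$ has first $2\times2$ block $I$ and all other blocks zero (so $B=[e_1\ e_2]$). The pair $(A,B)$ is called stabilizable if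 its uncontrollable modes are all stable, where stability of modes is meant in the (marginal) sense that states remain bounded: in a Kalman controllability decomposition of $(A,B)$, the uncontrollable block $A_{uc}$ has $e^{A_{uc}t}$ bounded for $t\ge0$; equivalently, all eigenvalues of $A_{uc}$ have nonpositive real part and those with zero real part are semisimple eigenvalues of $A_{uc}$. *)

(* Defs.v *)
From HB Require Import structures.
From mathcomp Require Import all_boot all_order all_algebra.
From mathcomp Require Import all_classical all_reals all_analysis.

Set Implicit Arguments.
Unset Strict Implicit.
Unset Printing Implicit Defensive.

Import Order.TTheory GRing.Theory Num.Theory.
Import numFieldNormedType.Exports.

Local Open Scope classical_set_scope.
Local Open Scope ring_scope.

(* The limit is taken in the normed module of matrices (max norm), where the
   series always converges. *)
Definition expmx (R : realType) (q : nat) (M : 'M[R]_q) : 'M[R]_q :=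
  limn (series (fun k : nat => k`!%:R^-1 *: M ^+ k)).

(* e^{Mt} is bounded for t >= 0. *)
Definition marginally_stable (R : realType) (q : nat) (M : 'M[R]_q) : Prop :=
  [bounded expmx (t *: M) | t in [set t : R | 0 <= t]].

(* [B  AB  ...  A^(r-1)B] *)
Definition ctrb_mx (R : realType) (r m : nat) (A : 'M[R]_r) (B : 'M[R]_(r, m)) :=
  \mxrow_(k < r) (A ^+ k *m B).

Definition controllable (R : realType) (r m : nat)
    (A : 'M[R]_r) (B : 'M[R]_(r, m)) : Prop :=
  \rank (ctrb_mx A B) = r.

(* P is the change of coordinates x = P z and Q its inverse; the two
   inverse equations force N = r + q, which spares a cast.  The cases r = 0
   and q = 0 are allowed. *)
Definition kalman_decomposition (R : realType) (N m r q : nat)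
    (A : 'M[R]_N) (B : 'M[R]_(N, m))
    (P : 'M[R]_(N, r + q)) (Q : 'M[R]_(r + q, N))
    (Ac : 'M[R]_r) (A12 : 'M[R]_(r, q)) (Auc : 'M[R]_q)
    (Bc : 'M[R]_(r, m)) : Prop :=
  [/\ P *m Q = 1%:M /\ Q *m P = 1%:M,
      Q *m A *m P = block_mx Ac A12 0 Auc,
      Q *m B = col_mx Bc 0 &
      controllable Ac Bc].

(* Stabilizability in the marginal sense.  Any two Kalman decompositions of
   (A, B) have similar uncontrollable blocks, so the choice is immaterial. *)
Definition stabilizable (R : realType) (N m : nat)
    (A : 'M[R]_N) (B : 'M[R]_(N, m)) : Prop :=
  exists (r q : nat) (P : 'M[R]_(N, r + q)) (Q : 'M[R]_(r + q, N))
    (Ac : 'M[R]_r) (A12 : 'M[R]_(r, q)) (Auc : 'M[R]_q) (Bc : 'M[R]_(r, m)),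
    kalman_decomposition A B P Q Ac A12 Auc Bc /\ marginally_stable Auc.

Definition mx22 (R : realType) (a b c d : R) : 'M[R]_2 :=
  \matrix_(i, j) nth 0 (nth [::] [:: [:: a; b]; [:: c; d]] i) j.

(* Vehicles are numbered 1, ..., n and blocks 0, ..., n-1, so block row i
   belongs to vehicle i.+1; the values of b1, b2, b3 outside 2..n are unused.
   The state space 'cV_(\sum_(i < n) 2) is R^(2n) partitioned into blocks of
   size 2.  A boolean exponent in _ *+ _ says where a contribution is put. *)
Definition traffic_mx (R : realType) (n : nat) (b1 b2 b3 : nat -> R)
    (J2 : 'M[R]_2) : 'M[R]_(\sum_(i < n) 2) :=
  \mxblock_(i < n, j < n)
    (mx22 0 (-1) 0 0 *+ ((val i == 0%N) && (val j == 0%N))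
     + J2 *+ ((val i == 0%N) && (val j == n.-1))
     + mx22 0 1 0 (b3 i.+1) *+ (val i == (val j).+1)
     + mx22 0 (-1) (b1 i.+1) (- b2 i.+1) *+ ((0 < i)%N && (val i == val j))
     : 'M[R]_2).

Definition ring_A (R : realType) (n : nat) (b1 b2 b3 : nat -> R) :=
  traffic_mx n b1 b2 b3 (mx22 0 1 0 0).

Definition ring_B (R : realType) (n : nat) : 'M[R]_(\sum_(i < n) 2, 1) :=
  \mxcol_(i < n) (delta_mx ord_max 0 *+ (val i == 0%N) : 'M[R]_(2, 1)).

Definition open_A (R : realType) (n : nat) (b1 b2 b3 : nat -> R) :=
  traffic_mx n b1 b2 b3 0.

Definition open_B (R : realType) (n : nat) : 'M[R]_(\sum_(i < n) 2, 2) :=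
  \mxcol_(i < n) (1%:M *+ (val i == 0%N) : 'M[R]_2).

(* Main.v *)
Require Import Defs.
From HB Require Import structures.
From mathcomp Require Import all_boot all_order all_algebra.
From mathcomp Require Import all_classical all_reals all_analysis.
From mathcomp Require Import ring lra.

Set Implicit Arguments.
Unset Strict Implicit.
Unset Printing Implicit Defensive.

Import Order.TTheory GRing.Theory Num.Theory.
Import numFieldNormedType.Exports.

Local Open Scope classical_set_scope.
Local Open Scope ring_scope.

(** A mode is uncontrollable when it is carried by a row vector [w] such that
    [w A^k B = 0] for all [k].  The whole argument is therefore run on such
    rows: if all entries of [w e^(tA)] stay bounded for [t >= 0] whenever [w]
    annihilates the reachable subspace, then the uncontrollable block of any
    Kalman decomposition has a bounded exponential, because the entries of that
    exponential are combinations of the entries of such orbits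
    ([stabilizable_of_bounded]).

    Let [(p_i, q_i)] be the two entries of [y(t) = w e^(tA)] that multiply the
    spacing and the speed of vehicle [i].  From [y' = y A], every human-driven
    vehicle contributes a damped oscillator
      [p_i' = b1_i q_i],   [q_i' = - p_i - b2_i q_i + r_i],
    whose input [r_i = p_(i+1) + b3_(i+1) q_(i+1)] comes from the following
    vehicle only, the last vehicle having no input other than what comes from
    the entries of vehicle 1.  So if the entries of vehicle 1 vanish along the
    whole orbit, the ring is cut open, and the vehicles can be treated from
    the last to the second: each one is input-to-state stable
    ([bounded_forward_vehicle], by a quadratic Lyapunov function), hence
    bounded since its input is ([bounded_forward_traffic]).

    On the open road [w A^k B] consists of exactly the two entries of
    vehicle 1, which therefore vanish.  On the ring road [w A^k B] is only the
    speed entry of vehicle 1.  The spacing entry of vehicle 1 vanishes in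
    every row [x A], since no equation of motion involves the spacing of the
    automated vehicle; it is only in [w] itself that it may be nonzero.
    Subtracting from [w] a multiple of the total spacing of the ring, which
    is a conserved quantity ([total_spacing_ring_A]), removes it.  That
    conserved quantity is the one marginal mode of the ring, and it adds a
    constant to the orbit. *)

(** * Functions bounded on the half-line *)

Definition bounded_forward (R : realType) (f : R -> R) : Prop :=
  exists K, forall t, 0 <= t -> `|f t| <= K.

Lemma bounded_forward_cst (R : realType) (c : R) :
  bounded_forward (fun=> c).
Proof. by exists `|c|. Qed.

Lemma bounded_forwardD (R : realType) (f g : R -> R) :
  bounded_forward f -> bounded_forward g ->
  bounded_forward (fun t => f t + g t).
Proof.
move=> [K fK] [L gL]; exists (K + L) => t t0.
by rewrite (le_trans (ler_normD _ _))// lerD// ?fK ?gL.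
Qed.

Lemma bounded_forwardZ (R : realType) (c : R) (f : R -> R) :
  bounded_forward f -> bounded_forward (fun t => c * f t).
Proof.
by move=> [K fK]; exists (`|c| * K) => t t0; rewrite normrM ler_wpM2l// fK.
Qed.

Lemma bounded_forward_sum (R : realType) (I : finType) (f : I -> R -> R) :
  (forall i, bounded_forward (f i)) ->
  bounded_forward (fun t => \sum_i f i t).
Proof.
move=> /(_ _)/cid-/all_sig[K fK]; exists (\sum_i K i) => t t0.
by rewrite (le_trans (ler_norm_sum _ _ _))// ler_sum// => i _; exact: fK.
Qed.

Lemma bounded_forward_sqr (R : realType) (f : R -> R) :
  bounded_forward (fun t => f t ^+ 2) -> bounded_forward f.
Proof.
move=> [K fK]; exists (K + 1) => t t0; move: (fK _ t0).
rewrite normrX; have := normr_ge0 (f t); set x := `|f t|; nra.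
Qed.

(** One-sided Gronwall: the function [(V t - b / a) e^(a t)] is
    nonincreasing. *)
Lemma bounded_above_of_linear_ineq (R : realType) (V V' : R -> R) (a b : R) :
  0 < a -> (forall t : R, is_derive t 1 V (V' t)) ->
  (forall t, 0 <= t -> V' t <= - a * V t + b) ->
  exists K, forall t, 0 <= t -> V t <= K.
Proof.
move=> a0 dV V'le; pose c := b / a.
pose g t := (V t - c) * expR (a * t).
have dg (t : R) : is_derive t 1 g ((V' t + a * V t - b) * expR (a * t)).
  apply: is_derive_eq; rewrite /GRing.scale /= /c.
  by field; rewrite gt_eqF.
have g_le t : 0 <= t -> g t <= g 0.
  move=> t0; apply: (@ler0_derive1_nincry _ g 0) => //.
  - move=> x; rewrite in_itv/= andbT => /ltW x0.
    rewrite derive1E (@derive_val _ _ _ _ _ _ _ (dg x)).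
    rewrite mulr_le0_ge0 ?expR_ge0//.
    by have := V'le _ x0; lra.
  - apply: continuous_subspaceT => x.
    exact/differentiable_continuous/derivable1_diffP; have [] := dg x.
exists (c + `|V 0 - c|) => t t0.
have := g_le _ t0; rewrite /g mulr0 expR0 mulr1 => h.
rewrite -lerBlDl leNgt; apply/negP => lt.
have e1 : 1 <= expR (a * t) by rewrite -expR0 ler_expR mulr_ge0// ltW.
have := ler_norm (V 0 - c); have := normr_ge0 (V 0 - c); nra.
Qed.

(** The unforced oscillator is asymptotically stable, so a bounded input gives
    a bounded response.  The Lyapunov function is
    [V = a p^2 + 2 p q + e q^2], with [e] and [a] chosen so that the unforced
    derivative is exactly [- 2 (p^2 + q^2)]: this is the solution of the
    Lyapunov equation of the 2x2 block. *)
Lemma bounded_forward_vehicle (R : realType) (b1 b2 : R) (p q r : R -> R) :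
  0 < b1 -> 0 < b2 ->
  (forall t : R, is_derive t 1 p (b1 * q t)) ->
  (forall t : R, is_derive t 1 q (- p t - b2 * q t + r t)) ->
  bounded_forward r -> bounded_forward p /\ bounded_forward q.
Proof.
move=> b1_gt0 b2_gt0 dp dq [L rL].
pose e := (b1 + 1) / b2; pose a := (e + b2) / b1.
have e0 : 0 < e by rewrite divr_gt0// addr_gt0.
have a0 : 0 < a by rewrite divr_gt0// addr_gt0.
have eE : e * b2 = b1 + 1 by rewrite divfK ?gt_eqF.
have aE : a * b1 = e + b2 by rewrite divfK ?gt_eqF.
(* [V] is positive definite *)
have ae : 1 < a * e.
  rewrite -(ltr_pM2r b1_gt0) mul1r mulrAC aE mulrDl [b2 * e]mulrC eE.
  by have := sqr_ge0 e; rewrite expr2; lra.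
pose V t := a * p t ^+ 2 + 2 * (p t * q t) + e * q t ^+ 2.
pose V' t := - 2 * (p t ^+ 2 + q t ^+ 2) + 2 * (p t + e * q t) * r t.
have dV (t : R) : is_derive t 1 V (V' t).
  apply: is_derive_eq; rewrite /GRing.scale /= /V'.
  have -> : e = (b1 + 1) / b2 by [].
  have -> : a = ((b1 + 1) / b2 + b2) / b1 by [].
  by field; rewrite !gt_eqF.
have V'le t : 0 <= t ->
    V' t <= - (a + e + 1)^-1 * V t + (1 + e ^+ 2) * L ^+ 2.
  move=> t0; have rt : r t ^+ 2 <= L ^+ 2.
    rewrite -[r t ^+ 2]ger0_norm ?sqr_ge0// normrX.
    by rewrite lerXn2r ?nnegrE ?(le_trans _ (rL _ t0)) ?rL.
  have h1 : V t <= (a + e + 1) * (p t ^+ 2 + q t ^+ 2).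
    rewrite /V; have := sqr_ge0 (p t - q t).
    by have := sqr_ge0 (p t); have := sqr_ge0 (q t); nra.
  have h2 : (a + e + 1)^-1 * V t <= p t ^+ 2 + q t ^+ 2.
    by rewrite ler_pdivrMl// !addr_gt0.
  (* Young's inequality gives half of the dissipation to the input. *)
  have h3 : V' t <= - (p t ^+ 2 + q t ^+ 2) + (1 + e ^+ 2) * r t ^+ 2.
    rewrite /V'; have := sqr_ge0 (p t - r t).
    by have := sqr_ge0 (q t - e * r t); nra.
  have h4 : (1 + e ^+ 2) * r t ^+ 2 <= (1 + e ^+ 2) * L ^+ 2.
    by rewrite ler_wpM2l// addr_ge0// sqr_ge0.
  lra.
have [|K VK] := bounded_above_of_linear_ineq _ dV V'le.
  by rewrite invr_gt0 !addr_gt0.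
split; apply: bounded_forward_sqr.
(* completing the square: [e V = (e q + p)^2 + (a e - 1) p^2] *)
- exists (e * K / (a * e - 1)) => t t0; rewrite ger0_norm ?sqr_ge0//.
  rewrite ler_pdivlMr ?subr_gt0// (le_trans _ (_ : e * V t <= _))//; last first.
    by rewrite ler_pM2l// VK.
  by rewrite /V; have := sqr_ge0 (e * q t + p t); nra.
- exists (a * K / (a * e - 1)) => t t0; rewrite ger0_norm ?sqr_ge0//.
  rewrite ler_pdivlMr ?subr_gt0// (le_trans _ (_ : a * V t <= _))//; last first.
    by rewrite ler_pM2l// VK.
  by rewrite /V; have := sqr_ge0 (a * p t + q t); nra.
Qed.

(** * The matrix exponential through its bilinear forms *)

Lemma powmxS (R : realType) (r : nat) (A : 'M[R]_r) k :
  A ^+ k.+1 = A *m A ^+ k.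
Proof. exact: exprS. Qed.

Lemma powmxSr (R : realType) (r : nat) (A : 'M[R]_r) k :
  A ^+ k.+1 = A ^+ k *m A.
Proof. exact: exprSr. Qed.

Lemma mx_exp_growth (R : realType) (q : nat) (M : 'M[R]_q) :
  exists2 C, 0 <= C & forall k i j, `|(M ^+ k) i j| <= C ^+ k.
Proof.
pose C := \sum_i \sum_j `|M i j|.
have C0 : 0 <= C by rewrite sumr_ge0// => i _; rewrite sumr_ge0.
have MC i : \sum_j `|M i j| <= C.
  by rewrite [leRHS](bigD1 i)//= lerDl sumr_ge0// => k _; rewrite sumr_ge0.
exists C => //; elim=> [|k IH] i j.
  by rewrite !expr0 mxE; case: eqP => _; rewrite ?normr1 ?normr0.
rewrite [M ^+ _]exprS mxE (le_trans (ler_norm_sum _ _ _))//.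
rewrite [C ^+ _]exprS (le_trans _ (_ : \sum_l `|M i l| * C ^+ k <= _))//.
  by apply: ler_sum => l _; rewrite normrM ler_wpM2l.
by rewrite -mulr_suml ler_wpM2r// exprn_ge0.
Qed.

Lemma is_cvg_exp_entry (R : realType) (q : nat) (M : 'M[R]_q) i j (t : R) :
  cvgn (pseries (fun k => k`!%:R^-1 * (M ^+ k) i j) t).
Proof.
have [C C0 MC] := mx_exp_growth M.
apply: normed_cvg.
apply: (@series_le_cvg _ _ (exp_coeff (C * `|t|))) => [k|k|k|] /=.
- exact: normr_ge0.
- by rewrite exp_coeff_ge0// mulr_ge0.
- rewrite /exp_coeff/= 2!normrM normrX normfV normr_nat exprMn.
  rewrite [leRHS]mulrC -mulrA ler_wpM2l ?invr_ge0//.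
  by rewrite ler_wpM2r ?exprn_ge0// MC.
- exact: is_cvg_series_exp_coeff.
Qed.

Lemma cvg_mx_entry (R : realType) (m q : nat) (u : nat -> 'M[R]_(m, q))
    (L : 'M[R]_(m, q)) :
  (forall i j, u n i j @[n --> \oo] --> L i j) -> u n @[n --> \oo] --> L.
Proof.
move=> uL; apply/cvgrPdist_le => /= e e0; near=> n.
rewrite /Num.Def.normr/= mx_normrE (bigmax_le _ (ltW e0))//= => i _.
rewrite !mxE/=; move: i; near: n; apply: filter_forall => i.
exact: ((cvgrPdist_le _ _).1 (uL i.1 i.2)).
Unshelve. all: by end_near. Qed.

Lemma scalemx_exp (R : realType) (q : nat) (M : 'M[R]_q) (t : R) k :
  (t *: M) ^+ k = t ^+ k *: M ^+ k.
Proof.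
elim: k => [|k IH]; first by rewrite !expr0 scale1r.
rewrite [LHS]exprS [M ^+ _]exprS IH -[LHS]/((t *: M) *m (t ^+ k *: M ^+ k)).
by rewrite -scalemxAl -scalemxAr scalerA -exprS.
Qed.

Lemma expmx_entry (R : realType) (q : nat) (M : 'M[R]_q) i j (t : R) :
  expmx (t *: M) i j = limn (pseries (fun k => k`!%:R^-1 * (M ^+ k) i j) t).
Proof.
rewrite /expmx; set s := series _.
suff sL : s n @[n --> \oo] -->
    \matrix_(i, j) limn (pseries (fun k => k`!%:R^-1 * (M ^+ k) i j) t).
  by rewrite (cvg_lim (@norm_hausdorff _ _) sL) mxE.
apply: cvg_mx_entry => {}i {}j; rewrite mxE.
suff -> : (fun n => s n i j) = pseries (fun k => k`!%:R^-1 * (M ^+ k) i j) t.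
  exact: is_cvg_exp_entry.
apply/funext => n; rewrite /s /pseries /series /= summxE.
apply: eq_bigr => k _; rewrite scalemx_exp scalerA mxE; ring.
Qed.

(** Everything about [expmx] is deduced from its bilinear forms
    [u e^(tM) v], which are real power series in [t]: differentiation,
    vanishing and intertwining then become statements on the numbers
    [u M^k v]. *)
Lemma cvg_expmx_form (R : realType) (q : nat) (M : 'M[R]_q)
    (u : 'rV[R]_q) (v : 'cV[R]_q) (t : R) :
  pseries (fun k => k`!%:R^-1 * (u *m M ^+ k *m v) 0 0) t @ \oo -->
  (u *m expmx (t *: M) *m v) 0 0.
Proof.
have -> : pseries (fun k => k`!%:R^-1 * (u *m M ^+ k *m v) 0 0) t =
    (fun n => \sum_j \sum_i u 0 i * v j 0 *
       pseries (fun k => k`!%:R^-1 * (M ^+ k) i j) t n).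
  apply/funext => n; rewrite /pseries /series /=.
  under [RHS]eq_bigr do under eq_bigr do rewrite mulr_sumr.
  under [RHS]eq_bigr do rewrite exchange_big.
  rewrite exchange_big; apply: eq_bigr => k _; rewrite /= mxE.
  rewrite mulr_sumr mulr_suml; apply: eq_bigr => j _.
  rewrite mxE mulr_suml mulr_sumr mulr_suml; apply: eq_bigr => i _; ring.
rewrite mxE; apply: cvg_big => [|j _]; first exact: add_continuous.
rewrite mxE mulr_suml; apply: cvg_big => [|i _]; first exact: add_continuous.
rewrite expmx_entry mulrAC; apply: cvgMl_tmp; exact: is_cvg_exp_entry.
Qed.

Lemma expmx_form (R : realType) (q : nat) (M : 'M[R]_q)
    (u : 'rV[R]_q) (v : 'cV[R]_q) (t : R) :
  (u *m expmx (t *: M) *m v) 0 0 =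
  limn (pseries (fun k => k`!%:R^-1 * (u *m M ^+ k *m v) 0 0) t).
Proof. by apply/esym/cvg_lim => //; exact: cvg_expmx_form. Qed.

(** Formal differentiation of the power series shifts the powers of [M] by
    one, because of the factorials; [v] is thereby replaced by [M v]. *)
Lemma is_derive_expmx_form (R : realType) (q : nat) (M : 'M[R]_q)
    (u : 'rV[R]_q) (v : 'cV[R]_q) (t : R) :
  is_derive t 1 (fun s : R => (u *m expmx (s *: M) *m v) 0 0)
    ((u *m expmx (t *: M) *m (M *m v)) 0 0).
Proof.
pose c (v : 'cV[R]_q) k := k`!%:R^-1 * (u *m M ^+ k *m v) 0 0.
have cvg_c w (s : R) : cvgn (pseries (c w) s).
  by apply/cvg_ex; eexists; exact: cvg_expmx_form.
have diffs_c w : pseries_diffs (c w) = c (M *m w).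
  apply/funext => k; rewrite /pseries_diffs /c factS natrM invfM mulrA mulVKf//.
  by rewrite exprSr !mulmxA.
rewrite expmx_form -/(c _) -diffs_c.
under [X in is_derive _ _ X _]eq_fun do rewrite expmx_form.
apply: (@pseries_snd_diffs _ _ (`|t| + 1)); rewrite ?diffs_c; try exact: cvg_c.
by rewrite [ltRHS]ger0_norm// ltrDl.
Qed.

(** Intertwining, as well as vanishing when the right-hand side is taken with
    zero vectors. *)
Lemma expmx_form_eq (R : realType) (p q : nat) (M : 'M[R]_p) (N : 'M[R]_q)
    (u : 'rV[R]_p) (v : 'cV[R]_p) (u' : 'rV[R]_q) (v' : 'cV[R]_q) (t : R) :
  (forall k, (u *m M ^+ k *m v) 0 0 = (u' *m N ^+ k *m v') 0 0) ->
  (u *m expmx (t *: M) *m v) 0 0 = (u' *m expmx (t *: N) *m v') 0 0.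
Proof.
move=> MN; rewrite !expmx_form; congr (limn (pseries _ t)).
by apply/funext => k; rewrite MN.
Qed.

Lemma expmx_left_kernel (R : realType) (q : nat) (A : 'M[R]_q)
    (w : 'rV[R]_q) (v : 'cV[R]_q) (t : R) : w *m A = 0 ->
  (w *m expmx (t *: A) *m v) 0 0 = (w *m expmx (0 *: A) *m v) 0 0.
Proof.
move=> wA.
apply: (@is_derive_0_is_cst _ (fun s => (w *m expmx (s *: A) *m v) 0 0)) => x.
apply: is_derive_eq; first exact: is_derive_expmx_form.
rewrite (@expmx_form_eq _ _ _ _ A _ _ 0 0) ?mul0mx ?mxE// => k.
by rewrite -mulmxA (mulmxA (A ^+ k)) -powmxSr powmxS !mulmxA wA !mul0mx.
Qed.

Lemma marginally_stable_entries (R : realType) (q : nat) (M : 'M[R]_q) :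
  (forall i j, bounded_forward (fun t => expmx (t *: M) i j)) ->
  marginally_stable M.
Proof.
move=> bM.
have {bM} bM (ij : 'I_q * 'I_q) :
    exists K : R, forall t, 0 <= t -> `|expmx (t *: M) ij.1 ij.2| <= K.
  exact: bM.
move: bM => /(_ _)/cid-/all_sig[K MK].
exists (\sum_ij `|K ij|); split; first exact: num_real.
move=> C /ltW KC t /= t0; apply: le_trans KC.
rewrite [leLHS]/Num.Def.normr/= mx_normrE; apply: bigmax_le => [|ij _].
  by rewrite sumr_ge0.
rewrite (le_trans (MK _ _ t0))// (le_trans (ler_norm _))// (bigD1 ij)//= lerDl.
by rewrite sumr_ge0.
Qed.

(** * Kalman decompositions and left annihilators *)

(** By Cayley-Hamilton, the remainder of ['X^k] modulo the characteristic
    polynomial can be evaluated instead of ['X^k]. *)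
Lemma powmx_lincomb (R : realType) (r : nat) (A : 'M[R]_r) (k : nat) :
  exists a : nat -> R, A ^+ k = \sum_(j < r) a j *: A ^+ j.
Proof.
case: r A => [|r] A.
  by exists (fun=> 0); rewrite [LHS]flatmx0 [RHS]flatmx0.
pose p := ('X^k %% char_poly A).
have char_neq0 : char_poly A != 0 by rewrite monic_neq0 ?char_poly_monic.
exists (fun j => p`_j).
have -> : A ^+ k = horner_mx A p.
  rewrite -[A in A ^+ _](horner_mx_X A) -rmorphXn (divp_eq 'X^k (char_poly A)).
  by rewrite rmorphD rmorphM /= Cayley_Hamilton mulr0 add0r.
have pE : p = \sum_(j < r.+1) p`_j *: 'X^j.
  rewrite -poly_def; apply/polyP => j; rewrite coef_poly; case: ltnP => // rj.
  rewrite nth_default// (leq_trans _ rj)// -ltnS.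
  by rewrite -(size_char_poly A) ltn_modp.
rewrite {1}pE rmorph_sum; apply: eq_bigr => j _ /=.
by rewrite linearZ /= rmorphXn /= horner_mx_X.
Qed.

(** The finite controllability matrix sees all powers of [A].  Stated on left
    multipliers, this spares any discussion of column spaces: a row is
    uncontrollable when it annihilates the controllability matrix. *)
Lemma mul_ctrb_mx_eq0 (R : realType) (s r m : nat) (W : 'M[R]_(s, r))
    (A : 'M[R]_r) (B : 'M[R]_(r, m)) :
  W *m ctrb_mx A B = 0 <-> forall k, W *m A ^+ k *m B = 0.
Proof.
rewrite mul_mxrow; split=> [|WAB].
  rewrite -[0]submxrowK => /eq_mxrowP WAB k.
  have [a ->] := powmx_lincomb A k.
  rewrite mulmx_sumr mulmx_suml big1// => j _.
  by rewrite -scalemxAr -scalemxAl -mulmxA WAB submxrow0 scaler0.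
rewrite -[RHS]submxrowK; apply/eq_mxrowP => k.
by rewrite submxrow0 mulmxA WAB.
Qed.

(** The first [r] columns of [L] form a basis of the reachable subspace, which
    is expressed by having the same left annihilators.  The change of
    coordinates is [L] itself.  The dimension [N] is a variable here, so that
    it can be replaced by [r + q] without casts. *)
Lemma kalman_of_reachable_basis (R : realType) (N m r q : nat)
    (A : 'M[R]_N) (B : 'M[R]_(N, m)) (L : 'M[R]_N) :
  N = (r + q)%N -> L \in unitmx ->
  (forall s (W : 'M[R]_(s, N)),
    (forall k, W *m A ^+ k *m B = 0) <->
    W *m (L *m (pid_mx r : 'M[R]_(N, r))) = 0) ->
  exists (P : 'M[R]_(N, r + q)) (Q : 'M[R]_(r + q, N))
    (Ac : 'M[R]_r) (A12 : 'M[R]_(r, q)) (Auc : 'M[R]_q) (Bc : 'M[R]_(r, m)),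
    kalman_decomposition A B P Q Ac A12 Auc Bc.
Proof.
move=> eN; subst N => Lunit annP; pose Q := invmx L.
have QL : Q *m L = 1%:M by rewrite mulVmx.
have LQ : L *m Q = 1%:M by rewrite mulmxV.
have Lpid : L *m pid_mx r = lsubmx L.
  by rewrite -{1}[L]hsubmxK pid_mx_col mul_row_col mulmx1 mulmx0 addr0.
(* The last rows of [L^-1] annihilate the first columns of [L], hence the
   reachable subspace; by its invariance so do their products by [A]. *)
have dQ0 k : dsubmx Q *m A ^+ k *m B = 0.
  move: k; apply/annP.
  by rewrite mulmxA mul_dsub_mx QL scalar_mx_block block_mxEv col_mxKd
    pid_mx_col mul_row_col mul0mx mulmx0 addr0.
have dQA0 : dsubmx Q *m A *m lsubmx L = 0.
  by rewrite -Lpid; apply/annP => k; rewrite -(mulmxA _ A) -powmxS.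
pose Ac := ulsubmx (Q *m A *m L); pose A12 := ursubmx (Q *m A *m L).
pose Auc := drsubmx (Q *m A *m L); pose Bc := usubmx (Q *m B).
have QAL : Q *m A *m L = block_mx Ac A12 0 Auc.
  rewrite -[LHS]submxK; congr block_mx.
  by rewrite /dlsubmx -!mul_dsub_mx -mulmx_lsub.
have QB : Q *m B = col_mx Bc 0.
  rewrite -[LHS]vsubmxK; congr col_mx.
  by rewrite -mul_dsub_mx -(dQ0 0) expr0 mulmx1.
have QAkB k : Q *m A ^+ k *m B = col_mx (Ac ^+ k *m Bc) 0.
  elim: k => [|k IH]; first by rewrite !expr0 !mulmx1 mul1mx.
  have QA : Q *m A = block_mx Ac A12 0 Auc *m Q.
    by rewrite -QAL -mulmxA LQ mulmx1.
  rewrite powmxS (mulmxA Q) QA -!mulmxA (mulmxA Q) IH mul_block_col.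
  by rewrite !mulmx0 mul0mx !addr0 mulmxA -powmxS.
exists L, Q, Ac, A12, Auc, Bc; split => //.
apply/eqP/inj_row_free => u /mul_ctrb_mx_eq0 uAB.
have /annP : forall k, u *m usubmx Q *m A ^+ k *m B = 0.
  by move=> k; rewrite -2!mulmxA !mul_usub_mx mulmxA QAkB col_mxKu mulmxA uAB.
rewrite -mulmxA (mulmxA (usubmx Q)) mul_usub_mx QL scalar_mx_block block_mxEv.
by rewrite col_mxKu pid_mx_col mul_row_col mul0mx addr0 mulmx1 mulmx1.
Qed.

(** Gaussian elimination of the controllability matrix provides an invertible
    matrix whose first columns span the reachable subspace. *)
Lemma kalman_decomposition_exists (R : realType) (N m : nat)
    (A : 'M[R]_N) (B : 'M[R]_(N, m)) :
  exists (r q : nat) (P : 'M[R]_(N, r + q)) (Q : 'M[R]_(r + q, N))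
    (Ac : 'M[R]_r) (A12 : 'M[R]_(r, q)) (Auc : 'M[R]_q) (Bc : 'M[R]_(r, m)),
    kalman_decomposition A B P Q Ac A12 Auc Bc.
Proof.
pose S := ctrb_mx A B; exists (\rank S), (N - \rank S)%N.
apply: (@kalman_of_reachable_basis _ _ _ _ _ _ _ (col_ebase S)).
- by rewrite subnKC// rank_leq_row.
- exact: col_ebase_unit.
move=> s W; rewrite -mul_ctrb_mx_eq0 -/S -/(col_base S).
split=> [|WS]; last by rewrite -(mulmx_base S) mulmxA WS mul0mx.
rewrite -{1}(mulmx_base S) mulmxA => /eqP.
by rewrite mulmx_free_eq0 ?row_base_free// => /eqP.
Qed.

(** The rows of [dsubmx Q] span the left annihilator of the reachable subspace,
    an invariant subspace on which [A] acts through the uncontrollable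
    block. *)
Lemma uncontrollable_rows (R : realType) (N m r q : nat)
    (A : 'M[R]_N) (B : 'M[R]_(N, m)) (P : 'M[R]_(N, r + q))
    (Q : 'M[R]_(r + q, N)) (Ac : 'M[R]_r) (A12 : 'M[R]_(r, q))
    (Auc : 'M[R]_q) (Bc : 'M[R]_(r, m)) (k : nat) :
  kalman_decomposition A B P Q Ac A12 Auc Bc ->
  dsubmx Q *m A ^+ k = Auc ^+ k *m dsubmx Q.
Proof.
move=> [[PQ QP] QAP _ _].
have dQA : dsubmx Q *m A = Auc *m dsubmx Q.
  rewrite mul_dsub_mx -[A]mulmx1 -PQ 2!mulmxA QAP.
  by rewrite -{1}(vsubmxK Q) mul_block_col col_mxKd mul0mx add0r.
elim: k => [|k IH]; first by rewrite !expr0 mulmx1 mul1mx.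
by rewrite 2!powmxSr mulmxA IH -mulmxA dQA mulmxA.
Qed.

(** The entries of [e^(t Auc)] are bilinear forms of [e^(tA)], taken between a
    row of [dsubmx Q], which is uncontrollable, and a column of
    [rsubmx P]. *)
Lemma stabilizable_of_bounded (R : realType) (N m : nat)
    (A : 'M[R]_N) (B : 'M[R]_(N, m)) :
  (forall w : 'rV[R]_N, (forall k, w *m A ^+ k *m B = 0) ->
    forall v : 'cV[R]_N,
      bounded_forward (fun t => (w *m expmx (t *: A) *m v) 0 0)) ->
  stabilizable A B.
Proof.
move=> bAB; have [r [q [P [Q [Ac [A12 [Auc [Bc kd]]]]]]]] :=
  kalman_decomposition_exists A B.
exists r, q, P, Q, Ac, A12, Auc, Bc; split=> //.
have [[_ QP] _ QB _] := kd.
have QP1 : dsubmx Q *m rsubmx P = 1%:M.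
  rewrite mulmx_rsub mul_dsub_mx QP scalar_mx_block -/(drsubmx _).
  exact: block_mxKdr.
apply: marginally_stable_entries => i j.
have -> : (fun t => expmx (t *: Auc) i j) = (fun t =>
    (row i (dsubmx Q) *m expmx (t *: A) *m col j (rsubmx P)) 0 0).
  apply/funext => t.
  transitivity
    ((delta_mx 0 i *m expmx (t *: Auc) *m delta_mx j 0 : 'M[R]_1) 0 0).
    by rewrite -rowE -colE !mxE.
  apply: expmx_form_eq => k.
  rewrite rowE colE -(mulmxA _ (dsubmx Q)) (uncontrollable_rows _ kd) !mulmxA.
  by rewrite -(mulmxA _ (dsubmx Q)) QP1 mulmx1.
apply: bAB => k.
by rewrite rowE -(mulmxA _ (dsubmx Q)) (uncontrollable_rows _ kd) -!mulmxA
  mul_dsub_mx QB col_mxKd !mulmx0.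
Qed.

(** * Rows partitioned by vehicle *)

Lemma ord2_cases (c : 'I_2) : c = 0 \/ c = 1.
Proof. by case: c => -[|[|]]// ?; [left|right]; exact: val_inj. Qed.

Lemma row2P (R : realType) (x y : 'rV[R]_2) :
  x 0 0 = y 0 0 -> x 0 1 = y 0 1 -> x = y.
Proof. by move=> xy0 xy1; apply/rowP => c; have [->|->] := ord2_cases c. Qed.

(** The index counts vehicles from 0.  It is a natural number, with value 0 out
    of range, so that the last vehicle has a follower contributing nothing. *)
Definition vehicle_cols (R : realType) (n m : nat)
    (y : 'M[R]_(m, \sum_(i < n) 2)) (k : nat) : 'M[R]_(m, 2) :=
  if insub k is Some i then @submxrow _ n (fun=> 2%N) m y i else 0.

Lemma vehicle_cols_ord (R : realType) (n : nat) m
    (y : 'M[R]_(m, \sum_(i < n) 2)) (i : 'I_n) :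
  vehicle_cols y i = submxrow y i.
Proof. by rewrite /vehicle_cols valK. Qed.

Lemma vehicle_cols_ge (R : realType) (n : nat) m
    (y : 'M[R]_(m, \sum_(i < n) 2)) k :
  (n <= k)%N -> vehicle_cols y k = 0.
Proof. by move=> nk; rewrite /vehicle_cols insubF// ltnNge nk. Qed.

Lemma mul_vehicle_cols (R : realType) (n : nat) m m'
    (x : 'M[R]_(m', m)) (y : 'M[R]_(m, \sum_(i < n) 2)) k :
  vehicle_cols (x *m y) k = x *m vehicle_cols y k.
Proof.
by rewrite /vehicle_cols; case: insub => [i|]; rewrite ?mul_submxrow ?mulmx0.
Qed.

Lemma vehicle_colsB (R : realType) (n : nat) m
    (x y : 'M[R]_(m, \sum_(i < n) 2)) k :
  vehicle_cols (x - y) k = vehicle_cols x k - vehicle_cols y k.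
Proof.
by rewrite /vehicle_cols; case: insub => [i|]; rewrite ?submxrowB ?subr0.
Qed.

Lemma vehicle_cols_entry (R : realType) (n : nat)
    (y : 'rV[R]_(\sum_(i < n) 2)) k c :
  vehicle_cols y k 0 c = (y *m col c (vehicle_cols 1%:M k)) 0 0.
Proof. by rewrite colE mulmxA -mul_vehicle_cols mulmx1 -colE !mxE. Qed.

Lemma sum_vehicle_cols (R : realType) (n : nat) m p
    (y : 'M[R]_(m, \sum_(i < n) 2))
    (X : nat -> 'M[R]_(2, p)) k :
  \sum_(i < n) (submxrow y i *m X i) *+ (val i == k) = vehicle_cols y k *m X k.
Proof.
have [kn|nk] := ltnP k n; last first.
  rewrite vehicle_cols_ge// mul0mx big1// => i _.
  have -> // : (val i == k) = false.
  by rewrite ltn_eqF// (leq_trans (ltn_ord i) nk).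
rewrite (bigD1 (Ordinal kn))//= eqxx -vehicle_cols_ord big1 ?addr0// => i.
by rewrite -val_eqE/= => /negPf ->.
Qed.

Lemma bounded_forward_rows (R : realType) (n : nat)
    (y : R -> 'rV[R]_(\sum_(i < n) 2)) :
  (forall k c, bounded_forward (fun t => vehicle_cols (y t) k 0 c)) ->
  forall v : 'cV[R]_(\sum_(i < n) 2),
    bounded_forward (fun t => (y t *m v) 0 0).
Proof.
move=> by_ v.
have -> : (fun t => (y t *m v) 0 0) = (fun t => \sum_(i < n) \sum_c
    submxcol v i c 0 * vehicle_cols (y t) i 0 c).
  apply/funext => t; rewrite -[y t]submxrowK -[v]submxcolK mul_mxrow_mxcol.
  rewrite summxE; apply: eq_bigr => i _; rewrite mxE; apply: eq_bigr => c _.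
  by rewrite vehicle_cols_ord mxrowK mxcolK mulrC.
do 2![apply: bounded_forward_sum => ?]; exact: bounded_forwardZ.
Qed.

(** * Dynamics of the vehicle chain *)

Lemma mul_row_mx22_0 (R : realType) (z : 'rV[R]_2) (a b c d : R) :
  (z *m mx22 a b c d) 0 0 = z 0 0 * a + z 0 1 * c.
Proof.
rewrite mxE big_ord_recl big_ord1 !mxE/=.
by congr (_ + z _ _ * _); apply/val_inj.
Qed.

Lemma mul_row_mx22_1 (R : realType) (z : 'rV[R]_2) (a b c d : R) :
  (z *m mx22 a b c d) 0 1 = z 0 0 * b + z 0 1 * d.
Proof.
rewrite mxE big_ord_recl big_ord1 !mxE/=.
by congr (_ + z _ _ * _); apply/val_inj.
Qed.

(** In the row equation [y' = y A], the vehicle with index [k] receives from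
    its follower [k.+1]: left multiplication transposes the chain. *)
Lemma vehicle_cols_traffic (R : realType) (n : nat) (b1 b2 b3 : nat -> R)
    (J2 : 'M[R]_2) m
    (y : 'M[R]_(m, \sum_(i < n) 2)) (k : nat) : (k < n)%N ->
  vehicle_cols (y *m traffic_mx n b1 b2 b3 J2) k =
    vehicle_cols y 0 *m mx22 0 (-1) 0 0 *+ (k == 0)%N
    + vehicle_cols y 0 *m J2 *+ (k == n.-1)
    + vehicle_cols y k.+1 *m mx22 0 1 0 (b3 k.+2)
    + vehicle_cols y k *m mx22 0 (-1) (b1 k.+1) (- b2 k.+1) *+ (0 < k)%N.
Proof.
move=> kn; rewrite -[k]/(val (Ordinal kn)) [LHS]vehicle_cols_ord /=.
rewrite -{1}[y]submxrowK /traffic_mx mul_mxrow_mxblock mxrowK.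
rewrite -(sum_vehicle_cols y (fun=> mx22 0 (-1) 0 0)).
rewrite -(sum_vehicle_cols y (fun=> J2)).
rewrite -(sum_vehicle_cols y (fun i => mx22 0 1 0 (b3 i.+1))).
rewrite -(sum_vehicle_cols y (fun i => mx22 0 (-1) (b1 i.+1) (- b2 i.+1))).
rewrite -!sumrMnl -!big_split; apply: eq_bigr => i _ /=.
rewrite !mulmxDr !raddfMn -!mulrnA !mulnb.
by congr (_ + _ *+ (_ : bool)); case: (_ =P k) => [->|]; rewrite ?andbT ?andbF.
Qed.

(** The matrix [J2], which closes the loop, multiplies only the entries of
    vehicle 1; where these vanish the system is a cascade, and boundedness is
    propagated from the last vehicle downwards. *)
Lemma bounded_forward_traffic (R : realType) (n : nat) (b1 b2 b3 : nat -> R)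
    (J2 : 'M[R]_2)
    (w : 'rV[R]_(\sum_(i < n) 2)) : let A := traffic_mx n b1 b2 b3 J2 in
  (forall i : nat, (2 <= i <= n)%N -> 0 < b1 i /\ 0 < b2 i) ->
  (forall k, vehicle_cols (w *m A ^+ k) 0 = 0) ->
  forall v : 'cV[R]_(\sum_(i < n) 2),
    bounded_forward (fun t => (w *m expmx (t *: A) *m v) 0 0).
Proof.
move=> A hb wA0; apply: bounded_forward_rows.
pose z i c (t : R) := vehicle_cols (w *m expmx (t *: A)) i 0 c.
have z0 t : vehicle_cols (w *m expmx (t *: A)) 0 = 0.
  apply/rowP => c; rewrite vehicle_cols_entry.
  rewrite (@expmx_form_eq _ _ _ _ A _ _ 0 0) ?mul0mx ?mxE// => k.
  by rewrite -vehicle_cols_entry wA0 !mul0mx !mxE.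
have dz i c (t : R) : is_derive t 1 (z i c)
    (vehicle_cols (w *m expmx (t *: A) *m A) i 0 c).
  rewrite vehicle_cols_entry -mulmxA.
  under [X in is_derive _ _ X _]eq_fun do rewrite vehicle_cols_entry.
  exact: is_derive_expmx_form.
(* induction on the distance [d] to the end of the chain *)
have bz d i : (n <= i + d)%N -> (0 < i)%N ->
    bounded_forward (z i 0) /\ bounded_forward (z i 1).
  elim: d i => [|d IH] i.
    rewrite addn0 => ni _.
    have zi0 c : z i c = fun=> 0.
      by apply/funext => t; rewrite /z vehicle_cols_ge// mxE.
    by rewrite !zi0; split; exact: bounded_forward_cst.
  rewrite addnS -addSn => nid i0.
  have [ni|i_n] := leqP n i.
    by apply: IH => //; rewrite (leq_trans ni)// leq_addr.
  have [bp bq] := IH _ nid isT.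
  have [hb1 hb2] : 0 < b1 i.+1 /\ 0 < b2 i.+1 by apply: hb; rewrite ltnS i0.
  have dp (t : R) : is_derive t 1 (z i 0) (b1 i.+1 * z i 1 t).
    apply: (is_derive_eq (dz i 0 t)).
    rewrite vehicle_cols_traffic// z0 !mul0mx !mul0rn !add0r i0 mulr1n.
    by rewrite mxE !mul_row_mx22_0 /z; ring.
  have dq (t : R) : is_derive t 1 (z i 1) (- z i 0 t - b2 i.+1 * z i 1 t +
      (z i.+1 0 t + b3 i.+2 * z i.+1 1 t)).
    apply: (is_derive_eq (dz i 1 t)).
    rewrite vehicle_cols_traffic// z0 !mul0mx !mul0rn !add0r i0 mulr1n.
    by rewrite mxE !mul_row_mx22_1 /z; ring.
  apply: (bounded_forward_vehicle hb1 hb2 dp dq).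
  by apply: bounded_forwardD => //; exact: bounded_forwardZ.
case=> [|i] c.
  under eq_fun do rewrite z0 mxE; exact: bounded_forward_cst.
have [bp bq] := bz n i.+1 (leq_addl _ _) isT.
by have [->|->] := ord2_cases c.
Qed.

(** * The ring road and the open road *)

Lemma mul_open_B (R : realType) (n : nat) m (y : 'M[R]_(m, \sum_(i < n) 2)) :
  y *m open_B R n = vehicle_cols y 0.
Proof.
rewrite -{1}[y]submxrowK /open_B mul_mxrow_mxcol -[RHS]mulmx1.
rewrite -(sum_vehicle_cols y (fun=> 1%:M)).
by apply: eq_bigr => i _; rewrite raddfMn.
Qed.

Lemma mul_ring_B (R : realType) (n : nat) m (y : 'M[R]_(m, \sum_(i < n) 2)) :
  y *m ring_B R n = col 1 (vehicle_cols y 0).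
Proof.
rewrite -{1}[y]submxrowK /ring_B mul_mxrow_mxcol colE.
rewrite -(sum_vehicle_cols y (fun=> delta_mx 1 0)).
apply: eq_bigr => i _; rewrite raddfMn.
by congr (_ *m delta_mx _ _ *+ _); exact: val_inj.
Qed.

(** The row that sums the spacings of all vehicles, the length of the ring. *)
Definition total_spacing (R : realType) (n : nat) : 'rV[R]_(\sum_(i < n) 2) :=
  \mxrow_(i < n) (delta_mx 0 0 : 'rV[R]_2).

Lemma vehicle_cols_total_spacing (R : realType) (n k : nat) : (k < n)%N ->
  vehicle_cols (total_spacing R n) k = delta_mx 0 0.
Proof.
by move=> kn; rewrite -[k]/(val (Ordinal kn)) vehicle_cols_ord mxrowK.
Qed.

(** Each speed appears in two spacing equations with opposite signs. *)
Lemma total_spacing_ring_A (R : realType) (n : nat) (b1 b2 b3 : nat -> R) :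
  (2 <= n)%N -> total_spacing R n *m ring_A n b1 b2 b3 = 0.
Proof.
move=> hn; have n0 : (0 < n)%N by exact: ltnW.
have spacing_row a b c d :
    delta_mx 0 0 *m mx22 a b c d =
    a *: delta_mx 0 0 + b *: delta_mx 0 1 :> 'rV[R]_2.
  by apply: row2P; rewrite ?mul_row_mx22_0 ?mul_row_mx22_1 !mxE/=; ring.
rewrite -[LHS]submxrowK -[RHS]submxrowK; apply/eq_mxrowP => k.
rewrite submxrow0 -vehicle_cols_ord vehicle_cols_traffic//.
rewrite !(vehicle_cols_total_spacing _ n0).
rewrite (vehicle_cols_total_spacing _ (ltn_ord k)).
rewrite !spacing_row !scale0r !add0r scaleN1r scale1r.
have -> : vehicle_cols (total_spacing R n) k.+1 *m mx22 0 1 0 (b3 k.+2) =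
    delta_mx 0 1 *+ (k.+1 < n)%N.
  have [kn|nk] := ltnP k.+1 n; last by rewrite vehicle_cols_ge// mul0mx.
  by rewrite vehicle_cols_total_spacing// spacing_row scale0r add0r scale1r.
have -> : (k == n.-1 :> nat) = ~~ (k.+1 < n)%N.
  by rewrite -leqNgt -eqSS prednK// eqn_leq ltn_ord.
have -> : (0 < k)%N = ~~ (k == 0 :> nat) by rewrite lt0n.
case: (_ == _); case: (_ < _)%N; rewrite /= ?mulr0n ?mulr1n ?addr0 ?add0r //.
all: by rewrite ?addNr ?subrr.
Qed.

Lemma ring_A_spacing0 (R : realType) (n : nat) (b1 b2 b3 : nat -> R)
    (y : 'rV[R]_(\sum_(i < n) 2)) : (2 <= n)%N ->
  vehicle_cols (y *m ring_A n b1 b2 b3) 0 0 0 = 0.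
Proof.
case: n y => [|[|n]]// y _.
rewrite vehicle_cols_traffic// ltnn /= !mulr0n !addr0 mulr1n mxE.
by rewrite !mul_row_mx22_0 !mulr0 !addr0.
Qed.

Theorem theorem1 (R : realType) (n : nat) (hn : (2 <= n)%N)
    (b1 b2 b3 : nat -> R)
    (hb : forall i : nat, (2 <= i <= n)%N -> [/\ 0 < b1 i, 0 < b2 i & 0 < b3 i]) :
  stabilizable (ring_A n b1 b2 b3) (ring_B R n)
  /\ stabilizable (open_A n b1 b2 b3) (open_B R n).
Proof.
have hb12 i : (2 <= i <= n)%N -> 0 < b1 i /\ 0 < b2 i by case/hb.
split; apply: stabilizable_of_bounded => w wAB v; last first.
  by apply: bounded_forward_traffic => // k; rewrite -mul_open_B.
set A := ring_A n b1 b2 b3 in wAB *.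
have head_speed k : vehicle_cols (w *m A ^+ k) 0 0 1 = 0.
  by move/(congr1 (fun M : 'M[R]_1 => M 0 0)): (wAB k); rewrite mul_ring_B !mxE.
(* removes the spacing entry of vehicle 1 from [w] *)
pose w0 := vehicle_cols w 0 0 0 *: total_spacing R n.
have w0A : w0 *m A = 0 by rewrite -scalemxAl total_spacing_ring_A// scaler0.
have -> : (fun t => (w *m expmx (t *: A) *m v) 0 0) = (fun t =>
    ((w - w0) *m expmx (t *: A) *m v) 0 0 + (w0 *m expmx (t *: A) *m v) 0 0).
  by apply/funext => t; rewrite -{1}(subrK w0 w) 2!mulmxDl mxE.
apply: bounded_forwardD; last first.
  under eq_fun do rewrite (expmx_left_kernel _ _ w0A).
  exact: bounded_forward_cst.
apply: bounded_forward_traffic => // -[|k].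
  rewrite expr0 mulmx1 vehicle_colsB /w0 -mul_scalar_mx mul_vehicle_cols.
  rewrite vehicle_cols_total_spacing ?(ltnW hn)// mul_scalar_mx.
  apply: row2P; rewrite !mxE/= ?mulr1 ?mulr0 ?subrr//.
  by have := head_speed 0%N; rewrite expr0 mulmx1 subr0.
rewrite powmxS mulmxA mulmxBl w0A subr0 -mulmxA -powmxS.
by apply: row2P; rewrite [RHS]mxE ?head_speed// powmxSr mulmxA ring_A_spacing0.
Qed.
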